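(* Let $K$ be a field, $n$ an integer and $1\leq k\leq n-1$. Then the join-meet ideal $I_{L_k}\subset K[L_k]$ is a radical ideal.
   Context: For a finite lattice $L$ and a field $K$, $K[L]$ is the polynomial ring over $K$ whose variables are the elements of $L$, and the join-meet ideal is $I_L=(ab-(a\wedge b)(a\vee b): a,b\in L \text{ incomparable})\subset K[L]$. Let $D$ be the distributive lattice with $2n$ elements $x_1,\dots,x_n,y_1,\dots,y_n$ ordered by: $x_i\le x_j$ iff $i\le j$; $y_i\le y_j$ iff $i\le j$; $x_i\le y_j$ iff $i\le j$; and never $y_i\le x_j$. For $1\le k\le n-1$, $L_k=D\cup\{z\}$ is the lattice obtained from $D$ by adding one new element $z$ with $x_i<z$ exactly for $i\le k$ and $z<y_j$ exactly for $j\ge k+1$, and $z$ incomparable to all other elements (namely $x_j$ for $j\ge k+1$ and $y_i$ for $i\le k$). Thus $\{x_k,x_{k+1},z,y_k,y_{k+1}\}$ is a diamond sublattice of $L_k$. *)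

(* Defs.v *)
From HB Require Import structures.
From mathcomp Require Import all_boot all_order all_algebra zify.
From mathcomp.multinomials Require Import mpoly.

Set Implicit Arguments.
Unset Strict Implicit.
Unset Printing Implicit Defensive.

Import Order.TTheory GRing.Theory.

Section Ideals.
Local Open Scope ring_scope.
Variable R : comNzRingType.

Definition ideal_generated (S : R -> Prop) (p : R) : Prop :=
  exists s : seq (R * R),
    (forall u, u \in s -> S u.2) /\ p = \sum_(u <- s) u.1 * u.2.

Definition radical (I : R -> Prop) (p : R) : Prop :=
  exists m : nat, (0 < m)%N /\ I (p ^+ m).

Definition is_radical_ideal (I : R -> Prop) : Prop :=
  forall p : R, radical I p <-> I p.

Lemma ideal_generated0 (S : R -> Prop) : ideal_generated S 0.
Proof. by exists [::]; rewrite big_nil. Qed.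

Lemma ideal_generatedD (S : R -> Prop) (p q : R) :
  ideal_generated S p -> ideal_generated S q -> ideal_generated S (p + q).
Proof.
move=> [s [hs ->]] [t [ht ->]]; exists (s ++ t); rewrite big_cat; split=> // u.
by rewrite mem_cat => /orP[/hs|/ht].
Qed.

Lemma ideal_generatedM (S : R -> Prop) (a p : R) :
  ideal_generated S p -> ideal_generated S (a * p).
Proof.
move=> [s [hs ->]]; exists [seq (a * u.1, u.2) | u <- s]; split.
  by move=> u /mapP[v /hs Sv ->].
by rewrite big_map mulr_sumr; apply: eq_bigr => u _; rewrite mulrA.
Qed.

Lemma mem_ideal_generated (S : R -> Prop) (p : R) : S p -> ideal_generated S p.
Proof.
move=> Sp; exists [:: (1, p)]; rewrite big_seq1 mul1r; split=> // u.
by rewrite inE => /eqP->.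
Qed.

End Ideals.

Section JoinMeetIdeal.
Local Open Scope ring_scope.
Variables (d : Order.disp_t) (L : finLatticeType d) (K : fieldType).

(* [{mpoly K[m]}] has variables indexed by ['I_m]; the variables are identified
   with the elements of [L] through the bijection [enum_rank : L -> 'I_#|L|]. *)
Definition lvar (a : L) : {mpoly K[#|L|]} := 'X_(enum_rank a).

Definition join_meet_binomial (a b : L) : {mpoly K[#|L|]} :=
  lvar a * lvar b - lvar (a `&` b)%O * lvar (a `|` b)%O.

Definition join_meet_ideal : {mpoly K[#|L|]} -> Prop :=
  ideal_generated
    (fun g => exists a b : L, (a >< b)%O /\ g = join_meet_binomial a b).

End JoinMeetIdeal.

(* Indices are shifted by one: [LX i], [LY i] with [i < n] are x_(i+1), y_(i+1).
   The type carries the bounds on [k], without which the order below need not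
   be a lattice. *)
Variant Lk (n k : nat) (hk : 0 < k < n) : Type :=
  LX of 'I_n | LY of 'I_n | LZ.

Arguments LX {n k hk}.
Arguments LY {n k hk}.
Arguments LZ {n k hk}.

Fact Lk_display : Order.disp_t. Proof. exact: Order.Disp tt tt. Qed.

Section LkLattice.
Variables (n k : nat) (hk : 0 < k < n).
Local Notation T := (Lk hk).

Definition Lk_code (a : T) : option ('I_n + 'I_n) :=
  match a with LX i => Some (inl i) | LY i => Some (inr i) | LZ => None end.

Definition Lk_decode (o : option ('I_n + 'I_n)) : T :=
  match o with Some (inl i) => LX i | Some (inr i) => LY i | None => LZ end.

Lemma Lk_codeK : cancel Lk_code Lk_decode.
Proof. by case. Qed.

HB.instance Definition _ := Finite.copy T (can_type Lk_codeK).

Definition Lk_le (a b : T) : bool :=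
  match a, b with
  | LX i, LX j | LX i, LY j | LY i, LY j => i <= j
  | LY _, LX _ => false
  | LX i, LZ => i < k
  | LZ, LY j => k <= j
  | LZ, LZ => true
  | LY _, LZ | LZ, LX _ => false
  end.

Let omin (i j : 'I_n) : 'I_n := if i <= j then i else j.
Let omax (i j : 'I_n) : 'I_n := if i <= j then j else i.

Lemma Lk_pred_proof : k.-1 < n. Proof. by lia. Qed.
Lemma Lk_k_proof : k < n. Proof. by lia. Qed.

(* the indices of x_k, y_k and of x_(k+1), y_(k+1) respectively *)
Definition Lk_lo : 'I_n := Ordinal Lk_pred_proof.
Definition Lk_hi : 'I_n := Ordinal Lk_k_proof.

Definition Lk_meet (a b : T) : T :=
  match a, b with
  | LX i, LX j | LX i, LY j | LY i, LX j => LX (omin i j)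
  | LY i, LY j => LY (omin i j)
  | LX i, LZ | LZ, LX i => LX (omin i Lk_lo)
  | LY i, LZ | LZ, LY i => if k <= i then LZ else LX i
  | LZ, LZ => LZ
  end.

Definition Lk_join (a b : T) : T :=
  match a, b with
  | LX i, LX j => LX (omax i j)
  | LX i, LY j | LY i, LX j | LY i, LY j => LY (omax i j)
  | LX i, LZ | LZ, LX i => if i < k then LZ else LY i
  | LY i, LZ | LZ, LY i => LY (omax i Lk_hi)
  | LZ, LZ => LZ
  end.

Lemma Lk_le_refl : reflexive Lk_le.
Proof. by case=> [i|i|] /=. Qed.

Lemma Lk_le_anti : antisymmetric Lk_le.
Proof.
by case=> [i|i|] [j|j|] //=; rewrite ?andbF // -?eqn_leq => /eqP/val_inj->.
Qed.

Lemma Lk_le_trans : transitive Lk_le.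
Proof. by case=> [i|i|] [j|j|] [l|l|] //=; lia. Qed.

HB.instance Definition _ :=
  Order.Le_isPOrder.Build Lk_display T
    Lk_le_refl Lk_le_anti Lk_le_trans.

Lemma Lk_meetP (a b c : T) : (a <= Lk_meet b c)%O = (a <= b)%O && (a <= c)%O.
Proof.
rewrite /Order.le /=.
by case: a => [i|i|]; case: b => [j|j|]; case: c => [l|l|] //=;
   rewrite /omin; do ?case: ifP => //= ?; lia.
Qed.

Lemma Lk_joinP (a b c : T) : (Lk_join a b <= c)%O = (a <= c)%O && (b <= c)%O.
Proof.
rewrite /Order.le /=.
by case: c => [i|i|]; case: a => [j|j|]; case: b => [l|l|] //=;
   rewrite /omax; do ?case: ifP => //= ?; lia.
Qed.

HB.instance Definition _ :=
  Order.POrder_MeetJoin_isLattice.Build Lk_display T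
    Lk_meetP Lk_joinP.

End LkLattice.

(* Main.v *)
From HB Require Import structures.
Require Import Defs.
From mathcomp Require Import all_boot all_order all_algebra zify.
From mathcomp.multinomials Require Import mpoly.

Set Implicit Arguments.
Unset Strict Implicit.
Unset Printing Implicit Defensive.

Import Order.TTheory GRing.Theory.

(** Write [x_i], [y_i], [z] for the variables; column [i] consists of [x_i] and
    [y_i], and a column is low if [i <= k] and high if [i > k].  (In the code
    indices start at 0, so that low means [i < k]; [lo] and [hi] are the
    columns [k] and [k + 1].)  The ideal [I] is generated by the 2-minors
    [x_i y_j - x_j y_i], by [z x_j - x_k y_j] for [j] high and by
    [z y_i - x_i y_(k+1)] for [i] low.

    [I] is radical because it is the intersection of the kernels of seven
    homomorphisms into polynomial rings.  Start from the monomial map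
      [x_i |-> s t_i], [y_i |-> t_i], with [t_k = s w], [t_(k+1) = w],
      [z |-> s w],
    and, for a set [S] of variables, compose it with the map that sends the
    variables outside [S] to 0.  For [S] take the set of all variables and the
    six sets
      all x; all y; [z] and the low x; [z] and the high y; the low columns;
      the high columns.
    Each resulting map kills the generators of [I] ([face_hom_binomial]).

    Conversely a polynomial [f] killed by the seven maps lies in [I].  As [I] is
    generated by differences of monomials, it suffices to compare monomials
    modulo [I]:
    - two monomials supported on the same one of the six sets and with the same
      image are congruent ([face_cong]);
    - two monomials supported on none of the six sets and with the same
      image under the full map are congruent ([mixed_cong], after the
      elimination of [z] in [off_faces_mixed]).
    One then peels off from [f] the terms supported on the first set, on the
    second one, and so on: at each stage the fibre sums of coefficients vanish,
    so the part removed lies in [I], and what is left at the end is treated with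
    the full map ([radical_of_faces]).

    The congruences between monomials rest on the classical fact that two
    monomials in the entries of a 2 x n matrix with the same column degrees and
    the same row degrees agree modulo the 2-minors ([segre_cong]), and on the
    consequence [x_k y_i y_j = z x_j y_i = x_i x_j y_(k+1)] modulo [I], for [i]
    low and [j] high, which moves one unit of degree from column [k] to column
    [k + 1] ([shift_column]). *)

Local Open Scope ring_scope.

(** * Monomials modulo an ideal *)

Section IdealCongruence.
Variables (N : nat) (K : fieldType) (G : {mpoly K[N]} -> Prop).
Implicit Types (m : 'X_{1..N}) (p q : {mpoly K[N]}).
Local Notation I := (ideal_generated G).

Lemma ideal_generatedN p : I p -> I (- p).
Proof. by move=> Ip; rewrite -mulN1r; apply: ideal_generatedM. Qed.

Lemma ideal_generatedZ (c : K) p : I p -> I (c *: p).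
Proof. by rewrite -mul_mpolyC; apply: ideal_generatedM. Qed.

Lemma ideal_generated_sum (J : eqType) (s : seq J) (F : J -> {mpoly K[N]}) :
  (forall j, j \in s -> I (F j)) -> I (\sum_(j <- s) F j).
Proof.
move=> IF; rewrite big_seq; elim/big_ind: _ => //.
- exact: ideal_generated0.
- by move=> p q; apply: ideal_generatedD.
Qed.

Lemma ideal_generated_ker (R : comNzRingType)
    (h : {rmorphism {mpoly K[N]} -> R}) p :
  (forall g, G g -> h g = 0) -> I p -> h p = 0.
Proof.
move=> hG [s [Gs ->]]; rewrite rmorph_sum big_seq big1 // => u /Gs/hG hu.
by rewrite rmorphM hu mulr0.
Qed.

Definition mcong m m' : Prop := I ('X_[m] - 'X_[m']).

Lemma mcong_refl m : mcong m m.
Proof. by rewrite /mcong subrr; apply: ideal_generated0. Qed.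

Lemma mcong_sym m m' : mcong m m' -> mcong m' m.
Proof. by move/ideal_generatedN; rewrite opprB. Qed.

Lemma mcong_trans m2 m1 m3 : mcong m1 m2 -> mcong m2 m3 -> mcong m1 m3.
Proof.
by move=> c12 /(ideal_generatedD c12); rewrite addrA subrK.
Qed.

Lemma mcong_add r m m' : mcong m m' -> mcong (r + m) (r + m').
Proof.
by move/(ideal_generatedM 'X_[r]); rewrite mulrBr -!mpolyXD.
Qed.

End IdealCongruence.

(** * Monomial maps restricted to faces, and a criterion for radicality *)
Section FaceHomomorphisms.
Variables (N M : nat) (K : fieldType) (W : 'I_N -> 'X_{1..M}).
Implicit Types (m : 'X_{1..N}) (S : {set 'I_N}).

Definition weight m : 'X_{1..M} := (\sum_i W i *+ m i)%MM.

Definition supported S m : bool := [forall i, (0 < m i)%N ==> (i \in S)].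

Definition face_hom S : {mpoly K[N]} -> {mpoly K[M]} :=
  mmap (@mpolyC M K) (fun i => if i \in S then 'X_[W i] else 0).

HB.instance Definition _ S := GRing.RMorphism.on (face_hom S).

Lemma supportedP S m :
  reflect (forall i, i \notin S -> m i = 0%N) (supported S m).
Proof.
apply: (iffP forallP) => [sm i|sm i].
  by have := sm i; case: (m i) => //= ? -> .
by apply/implyP; apply: contraLR => /sm->.
Qed.

Lemma supportedT m : supported setT m.
Proof. by apply/supportedP => i; rewrite inE. Qed.

Lemma weightD m m' : weight (m + m')%MM = (weight m + weight m')%MM.
Proof.
apply/mnmP => t; rewrite mnmDE !mnm_sumE -big_split; apply: eq_bigr => i _.
by rewrite !mulmnE mnmDE mulnDr.
Qed.

Lemma weight1 i : weight U_(i)%MM = W i.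
Proof.
apply/mnmP => t; rewrite mnm_sumE (bigD1 i) //= big1 => [|j /negbTE ij].
  by rewrite mulmnE mnm1E eqxx muln1 addn0.
by rewrite mulmnE mnm1E eq_sym ij muln0.
Qed.

Lemma face_homX S m :
  face_hom S 'X_[m] = if supported S m then 'X_[weight m] else 0.
Proof.
rewrite /face_hom mmapX /mmap1; case: ifP => [/supportedP sm|/negbT].
  rewrite /weight -mprodXE; apply: eq_bigr => i _; rewrite -mpolyXn.
  by case: ifP => // /negbT /sm ->; rewrite !expr0.
rewrite negb_forall => /existsP[i]; rewrite negb_imply => /andP[mi /negbTE iS].
by rewrite (bigD1 i) //= iS expr0n eqn0Ngt mi mul0r.
Qed.

Lemma face_homZX S (c : K) m :
  face_hom S (c *: 'X_[m]) = if supported S m then c *: 'X_[weight m] else 0.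
Proof.
rewrite {1}/face_hom mmapZ -/(face_hom S _) face_homX.
by case: ifP => _; rewrite ?mulr0 // mul_mpolyC.
Qed.

Variable G : {mpoly K[N]} -> Prop.

(** The coefficients of the terms in one fibre of the weight add up to a
    coefficient of the image, hence to 0; replacing every monomial of the fibre
    by a fixed one among them changes the sum by an element of the ideal. *)
Lemma fibre_sum (s : seq 'X_{1..N}) (c : 'X_{1..N} -> K) :
  {in s &, forall m m', weight m = weight m' -> mcong G m m'} ->
  \sum_(m <- s) c m *: 'X_[weight m] = 0 :> {mpoly K[M]} ->
  ideal_generated G (\sum_(m <- s) c m *: 'X_[m]).
Proof.
have [k] := ubnP (size s); elim: k s => // k IHk s /ltnSE sk cong_s sum0.
case: s sk cong_s sum0 => [|m0 s] sk cong_s sum0.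
  by rewrite big_nil; apply: ideal_generated0.
pose P m := weight m == weight m0.
set t := m0 :: s in sk cong_s sum0 *.
have cP : \sum_(m <- t | P m) c m = 0.
  have := congr1 (mcoeff (weight m0)) sum0.
  rewrite raddf0 raddf_sum /=; apply: etrans; rewrite big_mkcond.
  by apply: eq_bigr => m _; rewrite mcoeffZ mcoeffX /P; case: eqP => _;
     rewrite ?mulr1 ?mulr0.
have sumP (F : 'X_{1..N} -> 'X_{1..M}) : {in P, forall m, F m = weight m0} ->
    \sum_(m <- t | P m) c m *: 'X_[F m] = 0 :> {mpoly K[M]}.
  move=> FE; under eq_bigr => m Pm do rewrite FE //.
  by rewrite -scaler_suml cP scale0r.
rewrite (bigID P) /=; apply: ideal_generatedD.
  have -> : \sum_(m <- t | P m) c m *: 'X_[m] =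
            \sum_(m <- t | P m) c m *: ('X_[m] - 'X_[m0]) :> {mpoly K[N]}.
    under [RHS]eq_bigr do rewrite scalerBr.
    by rewrite sumrB -[X in _ - X]scaler_suml cP scale0r subr0.
  rewrite -big_filter; apply: ideal_generated_sum => m.
  rewrite mem_filter => /andP[/eqP Pm tm]; apply: ideal_generatedZ.
  by apply: cong_s => //; rewrite inE eqxx.
rewrite -big_filter; apply: IHk.
- apply: leq_trans sk; rewrite /= /P eqxx /= size_filter.
  by rewrite ltnS count_size.
- move=> m m'; rewrite !mem_filter => /andP[_ tm] /andP[_ tm'].
  exact: cong_s.
- rewrite big_filter; move: sum0; rewrite (bigID P) /= sumP ?add0r //.
  by move=> m /eqP.
Qed.

(** Induction on the list of faces.  The terms of [f] supported on the first
    face [S] form a polynomial with the same image as [f] under [face_hom S], so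
    they lie in the ideal and can be subtracted; the predicate [E] records that
    the remaining terms avoid the faces already treated. *)
Lemma mem_ideal_of_faces (ss : seq {set 'I_N}) (f : {mpoly K[N]})
    (E : pred 'X_{1..N}) :
  (forall S g, S \in setT :: ss -> G g -> face_hom S g = 0) ->
  (forall S m m', S \in ss -> supported S m -> supported S m' ->
     weight m = weight m' -> mcong G m m') ->
  (forall m m', E m -> E m' -> ~~ has (supported^~ m) ss ->
     ~~ has (supported^~ m') ss -> weight m = weight m' -> mcong G m m') ->
  {in msupp f, forall m, E m} ->
  (forall S, S \in setT :: ss -> face_hom S f = 0) ->
  ideal_generated G f.
Proof.
elim: ss f E => [|S ss IH] f E kerG faces generic Ef kerf.
  rewrite (mpolyE f); apply: fibre_sum => [m m' /Ef Em /Ef Em'|].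
    exact: generic.
  have := kerf setT (mem_head _ _); rewrite {1}(mpolyE f) rmorph_sum /=.
  apply: etrans.
  by apply: eq_bigr => m _; rewrite face_homZX supportedT.
pose fS := \sum_(m <- msupp f | supported S m) f@_m *: 'X_[m].
pose g := \sum_(m <- msupp f | ~~ supported S m) f@_m *: 'X_[m].
have fE : f = fS + g by rewrite {1}(mpolyE f) (bigID (supported S)).
have SG : ideal_generated G fS.
  rewrite /fS -big_filter; apply: fibre_sum => [m m'|].
    rewrite !mem_filter => /andP[Sm _] /andP[Sm' _].
    by apply: (faces S) => //; rewrite mem_head.
  have := kerf S; rewrite !inE eqxx orbT => /(_ isT).
  rewrite {1}fE rmorphD /= !rmorph_sum /= [X in _ + X]big1 ?addr0.
    by apply: etrans; rewrite big_filter; apply: eq_bigr => m Sm;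
       rewrite face_homZX Sm.
  by move=> m /negbTE Sm; rewrite face_homZX Sm.
have sub T : T \in setT :: ss -> T \in [:: setT, S & ss].
  by rewrite !inE => /orP[->|->] //; rewrite !orbT.
rewrite fE; apply: ideal_generatedD => //.
apply: (IH g (fun m => E m && ~~ supported S m)).
- by move=> T h /sub; apply: kerG.
- by move=> T m m' Ts; apply: faces; rewrite inE Ts orbT.
- move=> m m' /andP[Em Sm] /andP[Em' Sm'] nm nm'.
  by apply: generic => //=; rewrite negb_or ?Sm ?Sm'.
- move=> m /msupp_sum_le; rewrite -/g => /flatten_mapP[m'].
  rewrite mem_filter => /andP[Sm' fm'] /msuppZ_le; rewrite msuppX inE => /eqP->.
  by rewrite Ef.
- move=> T Ts; have := kerf T (sub T Ts); rewrite fE rmorphD /=.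
  rewrite (ideal_generated_ker (h := face_hom T) _ SG) ?add0r //.
  by move=> h; apply: kerG; apply: sub.
Qed.

(** The homomorphisms take values in a domain, so they kill [p] as soon as
    they kill a power of [p]. *)
Theorem radical_of_faces (ss : seq {set 'I_N}) :
  (forall S g, S \in setT :: ss -> G g -> face_hom S g = 0) ->
  (forall S m m', S \in ss -> supported S m -> supported S m' ->
     weight m = weight m' -> mcong G m m') ->
  (forall m m', ~~ has (supported^~ m) ss -> ~~ has (supported^~ m') ss ->
     weight m = weight m' -> mcong G m m') ->
  is_radical_ideal (ideal_generated G).
Proof.
move=> kerG faces generic p; split=> [[e [e0 Ipe]]|Ip]; last by exists 1%N.
apply: (mem_ideal_of_faces (E := predT) (ss := ss)) => //.
  by move=> m m' _ _; apply: generic.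
move=> S Ss; apply/eqP.
have : face_hom S p ^+ e == 0.
  rewrite -rmorphXn; apply/eqP; apply: (ideal_generated_ker _ Ipe) => g.
  exact: kerG.
by rewrite expf_eq0 e0.
Qed.

End FaceHomomorphisms.

(** * Degrees of a monomial in the variables of the lattice *)
Section DiamondMonomials.
Variables (n k : nat) (hk : (0 < k < n)%N).
Local Notation L := (Lk hk).
Local Notation mon := 'X_{1..#|{: L}|}.
Local Notation lo := (Lk_lo hk).
Local Notation hi := (Lk_hi hk).
Local Notation X i := (@LX n k hk i).
Local Notation Y i := (@LY n k hk i).
Local Notation Z := (@LZ n k hk).
Implicit Types (m r : mon) (v w : L) (i j : 'I_n).

Definition expo m v : nat := m (enum_rank v).
Definition var v : mon := U_(enum_rank v)%MM.

Definition colexp m i : nat := (expo m (X i) + expo m (Y i))%N.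
Definition xdeg m : nat := (\sum_i expo m (X i))%N.
Definition ydeg m : nat := (\sum_i expo m (Y i))%N.

Lemma expoD v m r : expo (m + r)%MM v = (expo m v + expo r v)%N.
Proof. exact: mnmDE. Qed.

Lemma expo_var v w : expo (var w) v = (w == v).
Proof. by rewrite /expo mnm1E (inj_eq enum_rank_inj). Qed.

Lemma colexpD i m r : colexp (m + r)%MM i = (colexp m i + colexp r i)%N.
Proof. by rewrite /colexp !expoD addnACA. Qed.

Lemma xdegD m r : xdeg (m + r)%MM = (xdeg m + xdeg r)%N.
Proof. by rewrite -big_split; apply: eq_bigr => i _; rewrite expoD. Qed.

Lemma ydegD m r : ydeg (m + r)%MM = (ydeg m + ydeg r)%N.
Proof. by rewrite -big_split; apply: eq_bigr => i _; rewrite expoD. Qed.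

Lemma sum_delta (F : 'I_n -> nat) i : (\sum_j F j * (j == i) = F i)%N.
Proof.
rewrite (bigD1 i) //= eqxx muln1 big1 ?addn0 // => j /negbTE->.
by rewrite muln0.
Qed.

Lemma colexp_var i v :
  colexp (var v) i = match v with LX j | LY j => j == i | LZ => false end.
Proof.
by rewrite /colexp !expo_var; case: v => [j|j|]; rewrite ?addn0.
Qed.

Lemma xdeg_var v : xdeg (var v) = if v is LX _ then 1%N else 0%N.
Proof.
rewrite /xdeg; under eq_bigr do rewrite expo_var.
case: v => [j|j|]; try by rewrite big1.
by rewrite -[RHS](sum_delta (fun=> 1%N) j); apply: eq_bigr => i _;
   rewrite mul1n eq_sym.
Qed.

Lemma ydeg_var v : ydeg (var v) = if v is LY _ then 1%N else 0%N.
Proof.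
rewrite /ydeg; under eq_bigr do rewrite expo_var.
case: v => [j|j|]; try by rewrite big1.
by rewrite -[RHS](sum_delta (fun=> 1%N) j); apply: eq_bigr => i _;
   rewrite mul1n eq_sym.
Qed.

Lemma zexp_var v : expo (var v) Z = if v is LZ then 1%N else 0%N.
Proof. by rewrite expo_var; case: v. Qed.

Definition degE := (expoD, colexpD, xdegD, ydegD,
                    zexp_var, colexp_var, xdeg_var, ydeg_var).

Lemma eq_mon m m' : expo m =1 expo m' -> m = m'.
Proof. by move=> e; apply/mnmP => i; rewrite -(enum_valK i); apply: e. Qed.

Lemma split_var m v : (0 < expo m v)%N -> exists r, m = (var v + r)%MM.
Proof.
move=> mv; exists (m - var v)%MM; apply/mnmP => i; rewrite mnmDE mnmBE.
by rewrite mnm1E; case: eqP => [<-|]; rewrite ?subn0 // subnKC.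
Qed.

Lemma xdeg_gt0 m : (0 < xdeg m)%N -> exists i, (0 < expo m (X i))%N.
Proof.
by rewrite lt0n sum_nat_eq0 negb_forall => /existsP[i]; rewrite -lt0n; exists i.
Qed.

Lemma ydeg_gt0 m : (0 < ydeg m)%N -> exists i, (0 < expo m (Y i))%N.
Proof.
by rewrite lt0n sum_nat_eq0 negb_forall => /existsP[i]; rewrite -lt0n; exists i.
Qed.

Lemma lo_neq_hi : lo != hi.
Proof. by rewrite -val_eqE /=; lia. Qed.

Lemma deg_split m :
  (xdeg m + ydeg m = colexp m lo + colexp m hi +
     \sum_(i | (i != lo) && (i != hi)) colexp m i)%N.
Proof.
rewrite -big_split (bigD1 lo) //= (bigD1 hi) 1?eq_sym ?lo_neq_hi //= addnA.
by congr addn; apply: eq_bigl => i; rewrite andbC.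
Qed.

(** * The weight *)

(** The index of the [t] that divides the image of a variable, after the
    substitutions [t_k = s w] and [t_(k+1) = w]: index [k - 1]
    (column [lo]) stands for [w], and index [k] (column [hi]) is not taken. *)
Definition col_weight v : nat :=
  match v with
  | LX i | LY i => if i == k :> nat then k.-1 else i
  | LZ => k.-1
  end.

(** The degree in [s]; the variables of column [lo] get one more because of the
    substitution [t_k = s w]. *)
Definition row_weight v : nat :=
  match v with
  | LX i => (i == k.-1 :> nat).+1
  | LY i => i == k.-1 :> nat
  | LZ => 1%N
  end.

Definition coord_weight (t : nat) v : nat :=
  if t == n then row_weight v else col_weight v == t.

Definition var_weight (i : 'I_#|{: L}|) : 'X_{1..n.+1} :=
  [multinom coord_weight t (enum_val i) | t < n.+1].

Lemma weightE m (t : 'I_n.+1) :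
  weight var_weight m t =
  (\sum_i expo m (X i) * coord_weight t (X i)
   + \sum_i expo m (Y i) * coord_weight t (Y i)
   + expo m Z * coord_weight t Z)%N.
Proof.
transitivity (\sum_(v : L) expo m v * coord_weight t v)%N.
  rewrite mnm_sumE (reindex (@enum_rank L)) /=; last first.
    by exists enum_val => v _; rewrite ?enum_rankK ?enum_valK.
  by apply: eq_bigr => v _; rewrite mulmnE mnmE enum_rankK mulnC.
rewrite (bigD1 Z) //= addnC; congr addn.
rewrite (bigID (fun v => if v is LX _ then true else false)) /=; congr addn.
  rewrite (reindex_onto (fun i => X i) (fun v => if v is LX i then i else lo)).
    by apply: eq_bigl => i /=; rewrite eqxx.
  by case=> //= i.
rewrite (reindex_onto (fun i => Y i) (fun v => if v is LY i then i else lo)).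
  by apply: eq_bigl => i /=; rewrite eqxx.
by case=> //= i.
Qed.

(** Equality of weights in terms of degrees.  The last clause, obtained from
    the first two by summing over the columns, gives access to the degree in the
    y. *)
Definition same_weight m m' : Prop :=
  [/\ forall i, i != lo -> i != hi -> colexp m i = colexp m' i,
      (colexp m lo + colexp m hi + expo m Z
       = colexp m' lo + colexp m' hi + expo m' Z)%N,
      (xdeg m + colexp m lo + expo m Z = xdeg m' + colexp m' lo + expo m' Z)%N
    & (xdeg m + ydeg m + expo m Z = xdeg m' + ydeg m' + expo m' Z)%N].

Lemma weight_col m i : i != lo -> i != hi ->
  weight var_weight m (widen_ord (leqnSn n) i) = colexp m i.
Proof.
rewrite -!val_eqE /= => ilo ihi; rewrite weightE /coord_weight /= ltn_eqF //.
rewrite eq_sym (negbTE ilo) muln0 addn0 /colexp.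
rewrite -[in RHS](sum_delta (fun i => expo m (X i))).
rewrite -[in RHS](sum_delta (fun i => expo m (Y i))).
have E j : ((if j == k :> nat then k.-1 else j : nat) == i) = (j == i).
  by rewrite -val_eqE /=; case: ifP => /eqP; lia.
by congr addn; apply: eq_bigr => j _; rewrite E.
Qed.

Lemma weight_lo m : weight var_weight m (widen_ord (leqnSn n) lo) =
  (colexp m lo + colexp m hi + expo m Z)%N.
Proof.
rewrite weightE /coord_weight /= ltn_eqF ?(Lk_pred_proof hk) // eqxx muln1.
have E j : ((if j == k :> nat then k.-1 else j : nat) == k.-1) =
           ((j == lo) + (j == hi))%N :> nat.
  by rewrite -!val_eqE /=; case: ifP => /eqP; lia.
under eq_bigr do rewrite E mulnDr.
under [T in (_ + T + _)%N]eq_bigr do rewrite E mulnDr.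
by rewrite !big_split /= !sum_delta /colexp; lia.
Qed.

Lemma weight_row m : weight var_weight m ord_max =
  (xdeg m + colexp m lo + expo m Z)%N.
Proof.
rewrite weightE /coord_weight /= eqxx muln1.
under eq_bigr do rewrite mulnS.
rewrite big_split /= (sum_delta (fun i => expo m (X i)) lo).
rewrite (sum_delta (fun i => expo m (Y i)) lo) /colexp /xdeg.
by rewrite !addnA.
Qed.

Lemma same_weight_of_weight m m' :
  weight var_weight m = weight var_weight m' -> same_weight m m'.
Proof.
move=> e.
have cE i : i != lo -> i != hi -> colexp m i = colexp m' i.
  by move=> ilo ihi; rewrite -!weight_col // e.
have loE : (colexp m lo + colexp m hi + expo m Z
       = colexp m' lo + colexp m' hi + expo m' Z)%N by rewrite -!weight_lo e.
split=> //; first by rewrite -!weight_row e.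
have sE : (\sum_(i | (i != lo) && (i != hi)) colexp m i =
           \sum_(i | (i != lo) && (i != hi)) colexp m' i)%N.
  by apply: eq_bigr => i /andP[]; apply: cE.
by rewrite !deg_split sE; lia.
Qed.

(** Together with the set of all variables, these are the sets of variables
    lying outside the various minimal primes of the ideal. *)
Variant face_label := FX | FY | FXZ | FYZ | Flow | Fhigh.

Definition face (c : face_label) : pred L := fun v =>
  match c, v with
  | FX, LX _ | FY, LY _ | FXZ, LZ | FYZ, LZ => true
  | FXZ, LX i | Flow, LX i | Flow, LY i => (i < k)%N
  | FYZ, LY i | Fhigh, LX i | Fhigh, LY i => (k <= i)%N
  | _, _ => false
  end.

Variable K : fieldType.

(** The generating set in the definition of [join_meet_ideal], named so that
    congruence of monomials can be stated relative to it. *)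
Definition join_meet_generator (g : {mpoly K[#|{: L}|]}) : Prop :=
  exists a b : L, (a >< b)%O /\ g = join_meet_binomial K a b.

Local Notation "m1 ~~~ m2" := (mcong join_meet_generator m1 m2) (at level 70).

Lemma join_meet_cong (a b : L) : (a >< b)%O ->
  (var a + var b)%MM ~~~ (var (a `&` b)%O + var (a `|` b)%O)%MM.
Proof.
move=> ab; rewrite /mcong !mpolyXD.
by apply: mem_ideal_generated; exists a, b.
Qed.

(** * The relations as moves on monomials *)
Lemma minor_lt i j : (i < j)%N ->
  (var (Y i) + var (X j))%MM ~~~ (var (X i) + var (Y j))%MM.
Proof.
move=> ij; have inc : (Y i >< X j)%O.
  by rewrite /Order.comparable /Order.le /= -ltnNge.
by have := join_meet_cong inc; rewrite /Order.meet /Order.join /= (ltnW ij).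
Qed.

Lemma minor_swap i j :
  (var (X i) + var (Y j))%MM ~~~ (var (X j) + var (Y i))%MM.
Proof.
have mC : (var (X j) + var (Y i) = var (Y i) + var (X j))%MM by rewrite addmC.
have mC' : (var (X i) + var (Y j) = var (Y j) + var (X i))%MM by rewrite addmC.
case: (ltngtP i j) => [ij|ij|/val_inj->]; last exact: mcong_refl.
- by rewrite mC; apply/mcong_sym/minor_lt.
- by rewrite mC'; apply: minor_lt.
Qed.

Lemma zx_move j : (k <= j)%N ->
  (var Z + var (X j))%MM ~~~ (var (X lo) + var (Y j))%MM.
Proof.
move=> kj; have inc : (Z >< X j)%O.
  by rewrite /Order.comparable /Order.le /= -leqNgt.
have := join_meet_cong inc; rewrite /Order.meet /Order.join /=.
by rewrite !ifF //; lia.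
Qed.

Lemma zy_move i : (i < k)%N ->
  (var Z + var (Y i))%MM ~~~ (var (X i) + var (Y hi))%MM.
Proof.
move=> ik; have inc : (Z >< Y i)%O.
  by rewrite /Order.comparable /Order.le /= orbF -ltnNge.
have := join_meet_cong inc; rewrite /Order.meet /Order.join /=.
by rewrite ifF ?ifT //; lia.
Qed.

(** * The 2-minors *)
Definition segre_eq m m' : Prop :=
  [/\ expo m Z = expo m' Z, xdeg m = xdeg m' & colexp m =1 colexp m'].

Lemma segre_eqI v m m' : segre_eq (var v + m)%MM (var v + m')%MM ->
  segre_eq m m'.
Proof.
case=> ez ex ec; split; last (move=> i; move: (ec i)).
all: move: ez ex; rewrite !degE; lia.
Qed.

(** If column [i] only contributes [y_i], then a 2-minor trades it, together
    with any [x_j] of [m], for [x_i] and [y_j]. *)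
Lemma extractX m i : (0 < xdeg m)%N -> (0 < colexp m i)%N ->
  exists r, m ~~~ (var (X i) + r)%MM /\ segre_eq m (var (X i) + r)%MM.
Proof.
move=> /xdeg_gt0[j mj]; case: (posnP (expo m (X i))) => [xi0|xi] ci.
  have /split_var[r1 m1] : (0 < expo m (Y i))%N by rewrite /colexp xi0 in ci.
  have /split_var[r2 r1E] : (0 < expo r1 (X j))%N.
    by move: mj; rewrite m1 expoD expo_var.
  exists (var (Y j) + r2)%MM; split.
    have -> : m = (r2 + (var (X j) + var (Y i)))%MM.
      by apply: eq_mon => v; rewrite m1 r1E !expoD; lia.
    have -> : (var (X i) + (var (Y j) + r2) = r2 + (var (X i) + var (Y j)))%MM.
      by apply: eq_mon => v; rewrite !expoD; lia.
    by apply: mcong_add; apply: minor_swap.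
  by rewrite m1 r1E; split=> [||l]; rewrite !degE; lia.
by have [r ->] := split_var xi; exists r; split=> //; apply: mcong_refl.
Qed.

Lemma extractY m i : (0 < ydeg m)%N -> (0 < colexp m i)%N ->
  exists r, m ~~~ (var (Y i) + r)%MM /\ segre_eq m (var (Y i) + r)%MM.
Proof.
move=> /ydeg_gt0[j mj]; case: (posnP (expo m (Y i))) => [yi0|yi] ci.
  have /split_var[r1 m1] : (0 < expo m (X i))%N.
    by rewrite /colexp yi0 addn0 in ci.
  have /split_var[r2 r1E] : (0 < expo r1 (Y j))%N.
    by move: mj; rewrite m1 expoD expo_var.
  exists (var (X j) + r2)%MM; split.
    have -> : m = (r2 + (var (X i) + var (Y j)))%MM.
      by apply: eq_mon => v; rewrite m1 r1E !expoD; lia.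
    have -> : (var (Y i) + (var (X j) + r2) = r2 + (var (X j) + var (Y i)))%MM.
      by apply: eq_mon => v; rewrite !expoD; lia.
    by apply: mcong_add; apply: minor_swap.
  by rewrite m1 r1E; split=> [||l]; rewrite !degE; lia.
by have [r ->] := split_var yi; exists r; split=> //; apply: mcong_refl.
Qed.

Lemma segre_eq_trans m2 m1 m3 :
  segre_eq m1 m2 -> segre_eq m2 m3 -> segre_eq m1 m3.
Proof.
by case=> z x e [z' x' e']; split=> [||i]; rewrite ?z ?x ?e.
Qed.

Lemma segre_ydeg m m' : segre_eq m m' -> ydeg m = ydeg m'.
Proof.
case=> _ ex ec; have := deg_split m; have := deg_split m'.
rewrite ex !ec; under eq_bigr do rewrite -ec.
lia.
Qed.

(** Induction on the degree: by extraction the second monomial can be made to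
    contain any given variable of the first one, and that variable is then
    cancelled from both. *)
Lemma segre_cong m m' : segre_eq m m' -> m ~~~ m'.
Proof.
have [d] := ubnP (mdeg m); elim: d m m' => // d IH m m' /ltnSE md mm'.
have step v r r' : m = (var v + r)%MM -> m' ~~~ (var v + r')%MM ->
    segre_eq m' (var v + r')%MM -> m ~~~ m'.
  move=> mE cr' sr'; apply: (mcong_trans _ (mcong_sym cr')).
  rewrite mE; apply: mcong_add; apply: IH.
    by move: md; rewrite mE mdegD mdeg1.
  by apply: (@segre_eqI v); rewrite -mE; apply: segre_eq_trans sr'.
case: (mm') => ez ex ec; have ey := segre_ydeg mm'.
have [z0|/split_var[r mE]] := posnP (expo m Z); last first.
  have /split_var[r' mE'] : (0 < expo m' Z)%N by rewrite -ez mE !degE.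
  by apply: (step Z r r' mE); rewrite mE'; [apply: mcong_refl | split].
have [x0|] := posnP (xdeg m); last first.
  move=> xm; have [i /split_var[r mE]] := xdeg_gt0 xm.
  have [||r' [c' s']] := @extractX m' i.
  - by rewrite -ex.
  - by rewrite -ec mE !degE eqxx.
  - exact: (step (X i) r r').
have [y0|] := posnP (ydeg m); last first.
  move=> ym; have [i /split_var[r mE]] := ydeg_gt0 ym.
  have [||r' [c' s']] := @extractY m' i.
  - by rewrite -ey.
  - by rewrite -ec mE !degE eqxx.
  - exact: (step (Y i) r r').
have zero p : expo p Z = 0%N -> xdeg p = 0%N -> ydeg p = 0%N ->
    expo p =1 (fun=> 0%N).
  move=> pz /eqP; rewrite sum_nat_eq0 => /forallP px.
  move=> /eqP; rewrite sum_nat_eq0 => /forallP py.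
  by case=> [i|i|] //; apply/eqP; [apply: px | apply: py].
have -> : m = m'; last exact: mcong_refl.
apply: eq_mon => v; rewrite (zero m) // (zero m') //.
- by rewrite -ez.
- by rewrite -ex.
- by rewrite -ey.
Qed.

(** * Monomials supported on none of the six faces *)

(** For a monomial without [z], being mixed amounts to being supported on none
    of the six faces; in general it is stronger, and every relation that removes
    a factor [z] produces a mixed monomial. *)
Definition mixed m : Prop :=
  [/\ (0 < xdeg m)%N, (0 < ydeg m)%N,
      exists2 i : 'I_n, (i < k)%N & (0 < colexp m i)%N
    & exists2 j : 'I_n, (k <= j)%N & (0 < colexp m j)%N].

Lemma mixedD m r : mixed m -> mixed (m + r)%MM.
Proof.
case=> x y [i ik ci] [j kj cj]; split; rewrite ?xdegD ?ydegD ?ltn_addr //.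
  by exists i; rewrite // colexpD ltn_addr.
by exists j; rewrite // colexpD ltn_addr.
Qed.

Lemma mixed_pair i j : (i < k)%N -> (k <= j)%N ->
  mixed (var (X i) + var (Y j))%MM.
Proof.
move=> ik kj; split; rewrite ?degE //.
  by exists i; rewrite // !degE eqxx.
by exists j; rewrite // !degE eqxx addn1.
Qed.

(** A high x or a low y absorbs [z] directly.  Otherwise being off the faces
    [FXZ] and [FYZ] provides a high y and a low x, which a 2-minor turns
    into a high x and a low y. *)
Lemma reduce_z m v w : (0 < expo m Z)%N ->
  (0 < expo m v)%N -> ~~ face FXZ v -> (0 < expo m w)%N -> ~~ face FYZ w ->
  exists m1, [/\ m ~~~ m1, (expo m Z = (expo m1 Z).+1) & mixed m1].
Proof.
have X_case j : (k <= j)%N -> (0 < expo m Z)%N -> (0 < expo m (X j))%N ->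
    exists m1, [/\ m ~~~ m1, (expo m Z = (expo m1 Z).+1) & mixed m1].
  move=> kj /split_var[r ->]; rewrite expoD expo_var => /split_var[s ->].
  exists ((var (X lo) + var (Y j)) + s)%MM; split.
  - by rewrite addmA ![(_ + s)%MM]addmC; apply/mcong_add/zx_move.
  - by rewrite !degE.
  - by apply/mixedD/mixed_pair => //=; lia.
have Y_case i : (i < k)%N -> (0 < expo m Z)%N -> (0 < expo m (Y i))%N ->
    exists m1, [/\ m ~~~ m1, (expo m Z = (expo m1 Z).+1) & mixed m1].
  move=> ik /split_var[r ->]; rewrite expoD expo_var => /split_var[s ->].
  exists ((var (X i) + var (Y hi)) + s)%MM; split.
  - by rewrite addmA ![(_ + s)%MM]addmC; apply/mcong_add/zy_move.
  - by rewrite !degE.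
  - by apply/mixedD/mixed_pair.
move=> zm; case: v => // [j|j].
  by move=> xj; rewrite /= -leqNgt => kj _ _; apply: (X_case j).
move=> yj _; case: (ltnP j k) => [jk|kj].
  by move=> _ _; apply: (Y_case j).
case: w => // i; last first.
  by move=> yi; rewrite /= -ltnNge => ik; apply: (Y_case i).
case: (leqP k i) => [ki|ik] xi _; first exact: (X_case i).
case/split_var: zm yj xi => r -> ; rewrite !expoD !expo_var !add0n.
move=> /split_var[s ->]; rewrite expoD expo_var => /split_var[t ->].
(* x_i y_j z = x_j y_i z = x_k y_j y_i modulo the ideal *)
exists ((var (X lo) + var (Y j)) + (var (Y i) + t))%MM; split.
- apply: (@mcong_trans _ _ _ ((var Z + t) + (var (X j) + var (Y i)))%MM).
    have -> : (var Z + (var (Y j) + (var (X i) + t)) =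
               (var Z + t) + (var (X i) + var (Y j)))%MM.
      by apply: eq_mon => v; rewrite !expoD; lia.
    by apply/mcong_add/minor_swap.
  have -> : (var Z + t + (var (X j) + var (Y i)) =
             (var (Y i) + t) + (var Z + var (X j)))%MM.
    by apply: eq_mon => v; rewrite !expoD; lia.
  by rewrite [T in _ ~~~ T]addmC; apply/mcong_add/zx_move.
- by rewrite !degE.
- by apply/mixedD/mixed_pair => //=; lia.
Qed.

Lemma mixed_eliminate_z m : mixed m ->
  exists m1, [/\ m ~~~ m1, expo m1 Z = 0%N & mixed m1].
Proof.
have [d] := ubnP (expo m Z); elim: d m => // d IH m /ltnSE zd mm.
have [z0|zm] := posnP (expo m Z).
  by exists m; split=> //; apply: mcong_refl.
case: (mm) => /xdeg_gt0[i xi] /ydeg_gt0[j yj] _ _.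
have [m1 [c1 z1 mm1]] :
    exists m1, [/\ m ~~~ m1, (expo m Z = (expo m1 Z).+1) & mixed m1].
  exact: (@reduce_z m (Y j) (X i)).
have [|m2 [c2 z2 mm2]] := IH m1 _ mm1; first by rewrite z1 in zd.
by exists m2; split=> //; apply: mcong_trans c2.
Qed.

(** The move [x_k y_i y_j = x_i x_j y_(k+1)], with [i] low and [j] high,
    decreases by one the degree in column [k] and keeps the weight.  Up to
    2-minors it applies to [m]: equality of the weights and the strict
    inequality force at least two y in [m], and the low column [i] is taken from
    [m'], so that it occurs in [m] beside the factor [x_k] even when
    [i = k]. *)
Lemma shift_column m m' :
  expo m Z = 0%N -> expo m' Z = 0%N -> mixed m -> mixed m' ->
  same_weight m m' ->
  (colexp m' lo < colexp m lo)%N ->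
  exists m1, [/\ m ~~~ m1, expo m1 Z = 0%N, mixed m1,
                 colexp m lo = (colexp m1 lo).+1 & same_weight m1 m'].
Proof.
move=> z0 z0' [xm ym _ [j kj cj]] [xm' ym' [i ik ci'] _].
case=> ce; rewrite z0 z0' !addn0 => pq xp xy ltp.
have ilo := lo_neq_hi.
have ihi : i != hi by rewrite -val_eqE /=; lia.
have jlo : (lo == j) = false by rewrite -val_eqE /=; lia.
have [r1 [c1 s1]] : exists r, m ~~~ (var (X lo) + r)%MM /\
    segre_eq m (var (X lo) + r)%MM.
  by apply: extractX => //; lia.
have y1 := segre_ydeg s1; case: (s1) => z1 x1 e1.
rewrite !degE in z1 x1 y1.
have [r2 [c2 s2]] : exists r, r1 ~~~ (var (Y i) + r)%MM /\
    segre_eq r1 (var (Y i) + r)%MM.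
  apply: extractY; first lia.
  move: (e1 i) ci'; rewrite !degE; case: (eqVneq lo i) => [<-|li]; first lia.
  have il : i != lo by rewrite eq_sym.
  by rewrite ce // => ->.
have y2 := segre_ydeg s2; case: (s2) => z2 x2 e2.
rewrite !degE in z2 x2 y2.
have [r3 [c3 s3]] : exists r, r2 ~~~ (var (Y j) + r)%MM /\
    segre_eq r2 (var (Y j) + r)%MM.
  apply: extractY; first lia.
  have := e1 j; have := e2 j; rewrite !degE jlo.
  have -> : (i == j) = false by rewrite -val_eqE /=; lia.
  lia.
have y3 := segre_ydeg s3; case: (s3) => z3 x3 e3.
rewrite !degE in z3 x3 y3.
pose m1 := ((var (X i) + var (Y hi)) + (var (X j) + r3))%MM.
have mm1 : m ~~~ m1.
  apply: mcong_trans c1 _.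
  apply: (@mcong_trans _ _ _ (var (X lo) + (var (Y i) + (var (Y j) + r3)))%MM).
    apply: mcong_add; apply: mcong_trans c2 _; exact: mcong_add.
  have -> : (var (X lo) + (var (Y i) + (var (Y j) + r3)) =
             (var (Y i) + r3) + (var (X lo) + var (Y j)))%MM.
    by apply: eq_mon => v; rewrite !expoD; lia.
  apply: (@mcong_trans _ _ _ ((var (Y i) + r3) + (var Z + var (X j)))%MM).
    by apply/mcong_add/mcong_sym/zx_move.
  have -> : (var (Y i) + r3 + (var Z + var (X j)) =
             (var (X j) + r3) + (var Z + var (Y i)))%MM.
    by apply: eq_mon => v; rewrite !expoD; lia.
  by rewrite /m1 [(var (X i) + _ + _)%MM]addmC; apply/mcong_add/zy_move.
have cE l : (colexp m l + (hi == l) = colexp m1 l + (lo == l))%N.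
  have := e1 l; have := e2 l; have := e3 l; rewrite /m1 !degE; lia.
have lohi : (lo == hi) = false by apply: negbTE.
have clo := cE lo; have chi := cE hi.
rewrite !eqxx eq_sym lohi in clo; rewrite !eqxx lohi in chi.
exists m1; split=> //.
- by rewrite /m1 !degE; lia.
- by apply/mixedD/mixed_pair.
- lia.
have x1E : xdeg m1 = (xdeg m).+1 by rewrite /m1 !degE; lia.
have y1E : ydeg m = (ydeg m1).+1 by rewrite /m1 !degE; lia.
have zE : expo m1 Z = 0%N by rewrite /m1 !degE; lia.
split; rewrite ?zE ?z0' ?x1E; try lia.
by move=> l llo lhi; rewrite -ce //; have := cE l;
   rewrite eq_sym (negbTE lhi) eq_sym (negbTE llo) !addn0.
Qed.

(** After enough shifts both monomials have the same degree in column [k]; the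
    weight then determines all the other degrees. *)
Lemma mixed_cong m m' :
  expo m Z = 0%N -> expo m' Z = 0%N -> mixed m -> mixed m' ->
  same_weight m m' ->
  m ~~~ m'.
Proof.
wlog le_p : m m' / (colexp m' lo <= colexp m lo)%N.
  move=> W z z' mm mm' e; case: (leqP (colexp m' lo) (colexp m lo)) => [le|lt].
    exact: W.
  apply: mcong_sym; apply: W => //; first exact: ltnW.
  by case: e => ce *; split=> // i il ih; rewrite ce.
have [d] := ubnP (colexp m lo); elim: d m le_p => // d IH m le_p /ltnSE pd.
move=> z z' mm mm' e; move: le_p; rewrite leq_eqVlt => /predU1P[pE|lt_p].
  case: e => ce pq xp xy; apply: segre_cong; split; try lia.
  move=> i; case: (eqVneq i lo) => [->|ilo]; first lia.
  by case: (eqVneq i hi) => [->|ihi]; [lia | apply: ce].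
have [m1 [c1 z1 mm1 p1 e1]] := shift_column z z' mm mm' e lt_p.
by apply: mcong_trans c1 _; apply: IH => //; lia.
Qed.

End DiamondMonomials.

Arguments var_weight {n k} hk i.

(** * The six faces and the proof of the theorem *)
Section Faces.
Variables (n k : nat) (hk : (0 < k < n)%N).
Local Notation L := (Lk hk).
Local Notation mon := 'X_{1..#|{: L}|}.
Local Notation lo := (Lk_lo hk).
Local Notation hi := (Lk_hi hk).
Local Notation X i := (@LX n k hk i).
Local Notation Y i := (@LY n k hk i).
Local Notation Z := (@LZ n k hk).
Implicit Types (m : mon) (v : L) (P : pred L).

Definition var_set P : {set 'I_#|{: L}|} := [set i | P (enum_val i)].

Lemma supported_var_set P m :
  reflect (forall v, ~~ P v -> expo m v = 0%N) (supported (var_set P) m).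
Proof.
apply: (iffP (supportedP _ _)) => [sm v Pv|sm i].
  by apply: sm; rewrite inE enum_rankK.
by rewrite inE => /sm; rewrite /expo enum_valK.
Qed.

Lemma unsupportedP P m :
  ~~ supported (var_set P) m -> exists2 v, ~~ P v & (0 < expo m v)%N.
Proof.
rewrite negb_forall => /existsP[i]; rewrite negb_imply inE => /andP[mi Pi].
by exists (enum_val i); rewrite // /expo enum_valK.
Qed.

Lemma supported_pair P v w :
  supported (var_set P) (var v + var w)%MM = P v && P w.
Proof.
apply/supported_var_set/andP => [s|[Pv Pw] u].
  by split; apply: contraT => /s; rewrite expoD !expo_var eqxx ?addn1.
by rewrite expoD !expo_var; case: eqP => [<-|_]; case: eqP => [<-|_];
  rewrite ?Pv ?Pw.
Qed.

Lemma weight_pair v w :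
  weight (var_weight hk) (var v + var w)%MM =
  [multinom (coord_weight t v + coord_weight t w)%N | t < n.+1].
Proof.
by rewrite weightD !weight1; apply/mnmP => t; rewrite mnmDE !mnmE !enum_rankK.
Qed.

Definition faces : seq {set 'I_#|{: L}|} :=
  [seq var_set (face c) | c <- [:: FX; FY; FXZ; FYZ; Flow; Fhigh]].

Lemma mem_facesP S : S \in faces -> exists c, S = var_set (face c).
Proof.
by rewrite /faces !inE; do 5?[case/orP]; move=> /eqP->;
  [exists FX | exists FY | exists FXZ | exists FYZ | exists Flow
  | exists Fhigh].
Qed.

Lemma off_faces m c : ~~ has (fun S => supported S m) faces ->
  exists2 v, ~~ face c v & (0 < expo m v)%N.
Proof.
by move=> /hasPn off; apply/unsupportedP/off; case: c; rewrite !inE eqxx ?orbT.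
Qed.

Lemma weight_meet_join (a b : L) t : (a >< b)%O ->
  (coord_weight t a + coord_weight t b
   = coord_weight t (a `&` b)%O + coord_weight t (a `|` b)%O)%N.
Proof.
rewrite /Order.comparable /Order.le /Order.meet /Order.join /= /coord_weight.
by case: (t == n); case: a => [i|i|]; case: b => [j|j|] //=;
  do ?case: ifP => /=; lia.
Qed.

Lemma face_closed c (a b : L) : (a >< b)%O ->
  face c a && face c b = face c (a `&` b)%O && face c (a `|` b)%O.
Proof.
rewrite /Order.comparable /Order.le /Order.meet /Order.join /=.
by case: c; case: a => [i|i|]; case: b => [j|j|] //=;
  do ?case: ifP => /=; lia.
Qed.

Variable K : fieldType.
Local Notation G := (@join_meet_generator n k hk K).

(** The two monomials of a generator have the same weight, and a face contains
    both variables of one if and only if it contains both variables of the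
    other. *)
Lemma face_hom_binomial S g : S \in setT :: faces -> G g ->
  face_hom (var_weight hk) S g = 0.
Proof.
move=> Sf [a [b [ab ->]]].
rewrite /join_meet_binomial /lvar -!mpolyXD -!/(var _) rmorphB /= !face_homX.
have -> : supported S (var a + var b)%MM =
          supported S (var (a `&` b)%O + var (a `|` b)%O)%MM.
  move: Sf; rewrite inE => /predU1P[->|/mem_facesP[c ->]].
    by rewrite !supportedT.
  by rewrite !supported_pair face_closed.
rewrite !weight_pair.
have -> : [multinom (coord_weight t a + coord_weight t b)%N | t < n.+1] =
    [multinom (coord_weight t (a `&` b)%O
               + coord_weight t (a `|` b)%O)%N | t < n.+1].
  by apply/mnmP => t; rewrite !mnmE weight_meet_join.
exact: subrr.
Qed.

Lemma mcong_weight m m' : mcong G m m' ->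
  weight (var_weight hk) m = weight (var_weight hk) m'.
Proof.
move=> c.
have : face_hom (var_weight hk) setT ('X_[m] - 'X_[m'] : {mpoly K[_]}) = 0.
  apply: (ideal_generated_ker _ c) => g.
  by apply: face_hom_binomial; apply: mem_head.
rewrite rmorphB /= !face_homX !supportedT => /eqP; rewrite subr_eq0.
move=> /eqP/(congr1 (mcoeff (weight (var_weight hk) m))).
rewrite !mcoeffX eqxx; case: eqP => // _ /eqP; by rewrite oner_eq0.
Qed.

(** On each face enough of the degrees vanish for the weight to determine the
    others. *)
Lemma face_cong c m m' :
  supported (var_set (face c)) m -> supported (var_set (face c)) m' ->
  same_weight m m' -> mcong G m m'.
Proof.
move=> sm sm' [ce pq xp xy].
have zero p : supported (var_set (face c)) p ->
    match c with
    | FX => ydeg p = 0%N /\ expo p Z = 0%N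
    | FY => xdeg p = 0%N /\ expo p Z = 0%N
    | FXZ => ydeg p = 0%N /\ colexp p hi = 0%N
    | FYZ => xdeg p = 0%N /\ colexp p lo = 0%N
    | Flow => colexp p hi = 0%N /\ expo p Z = 0%N
    | Fhigh => colexp p lo = 0%N /\ expo p Z = 0%N
    end.
  move=> /supported_var_set s.
  have lok : (k <= lo)%N = false by rewrite /=; lia.
  case: c s {sm sm'} => s; do ?split=> //;
    rewrite /xdeg /ydeg /colexp ?s //= ?lok //;
    try by [rewrite ltnn | rewrite big1 // => i _; rewrite s].
suff E : [/\ expo m Z = expo m' Z, xdeg m = xdeg m', colexp m lo = colexp m' lo
         & colexp m hi = colexp m' hi].
  case: E => z x l h; apply: segre_cong; split=> // i.
  case: (eqVneq i lo) => [->|ilo] //.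
  by case: (eqVneq i hi) => [->|ihi] //; apply: ce.
have := zero _ sm; have := zero _ sm'.
by case: c {zero sm sm'} => /= *; split; lia.
Qed.

(** Each face that does not support [m] provides a variable of [m] outside it.
    If [z] does not occur, the faces [FY], [FX], [Fhigh], [Flow] give the
    four conditions of mixedness. *)
Lemma off_faces_mixed m : ~~ has (fun S => supported S m) faces ->
  exists m1, [/\ mcong G m m1, expo m1 Z = 0%N & mixed m1].
Proof.
move=> off.
have [v vXZ v0] := off_faces FXZ off.
have [w wYZ w0] := off_faces FYZ off.
have [z0|zm] := posnP (expo m Z); last first.
  have [m1 [c1 _ mm1]] := reduce_z K zm v0 vXZ w0 wYZ.
  have [m2 [c2 z2 mm2]] := mixed_eliminate_z K mm1.
  by exists m2; split=> //; apply: mcong_trans c2.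
exists m; split=> //; first exact: mcong_refl.
have xpos i : (0 < expo m (X i))%N -> (0 < xdeg m)%N.
  by move=> xi; rewrite /xdeg (bigD1 i) //= ltn_addr.
have ypos i : (0 < expo m (Y i))%N -> (0 < ydeg m)%N.
  by move=> yi; rewrite /ydeg (bigD1 i) //= ltn_addr.
split.
- have [[i|i|] //= _] := off_faces FY off; [exact: xpos | by rewrite z0].
- have [[i|i|] //= _] := off_faces FX off; [exact: ypos | by rewrite z0].
- have [[i|i|] /=] := off_faces Fhigh off; rewrite -?ltnNge ?z0 // => ik e0.
    by exists i; rewrite // /colexp ltn_addr.
  by exists i; rewrite // /colexp ltn_addl.
- have [[i|i|] /=] := off_faces Flow off; rewrite -?leqNgt ?z0 // => ik e0.
    by exists i; rewrite // /colexp ltn_addr.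
  by exists i; rewrite // /colexp ltn_addl.
Qed.

End Faces.

Local Close Scope ring_scope.

Theorem theorem3p3 (K : fieldType) (n k : nat) (hk : 0 < k < n) :
  is_radical_ideal (@join_meet_ideal _ (Lk hk) K).
Proof.
apply: (radical_of_faces (W := var_weight hk) (ss := faces hk)).
- exact: face_hom_binomial.
- move=> S m m' /mem_facesP[c ->] sm sm' /same_weight_of_weight.
  exact: face_cong sm sm'.
- move=> m m' off off' e.
  have [m1 [c1 z1 mm1]] := off_faces_mixed K off.
  have [m2 [c2 z2 mm2]] := off_faces_mixed K off'.
  apply: (mcong_trans c1); apply: (mcong_trans _ (mcong_sym c2)).
  apply: mixed_cong => //; apply: same_weight_of_weight.
  by rewrite -(mcong_weight c1) -(mcong_weight c2).
Qed.
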